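(* Let $r\ge 2$, $s\ge 2$, $t\ge 2$ be integers. Let $H$ be an $(m,n)$-hm-bipartite linear $r$-uniform hypergraph with hm-bipartition $V(H)=V_1\cup V_2$, $|V_1|=m$, $|V_2|=n$, which is exact $\mathcal{B}_r(K_{s,t})$-free. Suppose further that $H$ is $\mathcal{B}_r(C_3)$-free. Then for every $k\in\{0,1,\ldots,t-2\}$, \[ e(H)\le\frac{(t-k-1)^{\frac{1}{s}}}{r-1}mn^{1-\frac{1}{s}}+\frac{s-1}{r-1}n^{1+\frac{k}{s}}+km.\]
   Context: An $r$-uniform hypergraph has every edge an $r$-element subset of the vertex set; it is linear if any two distinct edges share at most one vertex; $e(H)$ is its number of edges. It is hm-bipartite with hm-bipartition $V(H)=V_1\cup V_2$ (head part $V_1$, mass part $V_2$) if every edge meets $V_1$ in exactly one vertex and $V_2$ in exactly $r-1$ vertices; it is $(m,n)$-hm-bipartite if $|V_1|=m$, $|V_2|=n$. For a simple graph $F$, an $r$-uniform hypergraph is a Berge-$F$ if $V(F)$ is contained in its vertex set and there is a bijection $\phi$ from $E(F)$ to its edge set with $e\subseteq\phi(e)$ for all $e\in E(F)$; $\mathcal{B}_r(F)$ is the family of all $r$-uniform Berge-$F$ hypergraphs, and $H$ is $\mathcal{B}_r(F)$-free if it contains no subhypergraph isomorphic to a member of $\mathcal{B}_r(F)$. $C_3$ is the triangle and $K_{s,t}$ the complete bipartite graph with parts of sizes $s$ and $t$. An hm-bipartite $H$ is exact $\mathcal{B}_r(K_{s,t})$-free if it contains no subhypergraph isomorphic to a member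 of $\mathcal{B}_r(K_{s,t})$ in which the $s$-vertex part of $K_{s,t}$ lies in the head part $V_1$ and the $t$-vertex part lies in the mass part $V_2$. *)

(* Defs.v *)
From mathcomp Require Import all_boot.

Set Implicit Arguments.
Unset Strict Implicit.
Unset Printing Implicit Defensive.

Record hypergraph (T : finType) := Hypergraph {
  vset : {set T};
  eset : {set {set T}};
  eset_sub : forall e, e \in eset -> e \subset vset
}.

Definition uniform (T : finType) (r : nat) (H : hypergraph T) : Prop :=
  forall e, e \in eset H -> #|e| = r.

Definition linear_hypergraph (T : finType) (H : hypergraph T) : Prop :=
  forall e f, e \in eset H -> f \in eset H -> e != f -> #|e :&: f| <= 1.

Definition subhypergraph (T : finType) (B H : hypergraph T) : Prop :=
  vset B \subset vset H /\ eset B \subset eset H.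

(* [V1] is the head part and [V2] the mass part. *)
Definition hm_bipartition (T : finType) (r : nat) (H : hypergraph T)
    (V1 V2 : {set T}) : Prop :=
  [/\ V1 :|: V2 = vset H,
      [disjoint V1 & V2] &
      forall e, e \in eset H -> #|e :&: V1| = 1 /\ #|e :&: V2| = r - 1].

(* A simple graph is a 2-uniform hypergraph. [berge_at r F B i] says that [B]
   is an r-uniform Berge-[F] when the vertices of [F] are identified with
   vertices of [B] along the injection [i]; letting [i] vary makes the family
   of Berge-[F] hypergraphs closed under isomorphism. The map [phi] restricts
   to a bijection from [eset F] onto [eset B]. *)
Definition berge_at (U T : finType) (r : nat) (F : hypergraph U)
    (B : hypergraph T) (i : U -> T) : Prop :=
  [/\ uniform r B,
      {in vset F &, injective i},
      i @: vset F \subset vset B &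
      exists phi : {set U} -> {set T},
        [/\ {in eset F &, injective phi},
            phi @: eset F = eset B &
            forall e, e \in eset F -> i @: e \subset phi e]].

Definition berge_free (U T : finType) (r : nat) (F : hypergraph U)
    (H : hypergraph T) : Prop :=
  ~ exists (B : hypergraph T) (i : U -> T),
      subhypergraph B H /\ berge_at r F B i.

Lemma eset_subT (T : finType) (E : {set {set T}}) (e : {set T}) :
  e \in E -> e \subset [set: T].
Proof. by move=> _; apply: subsetT. Qed.

Definition triangle : hypergraph 'I_3 :=
  Hypergraph (@eset_subT _ [set e : {set 'I_3} | #|e| == 2]).

Definition Kbip_edges (s t : nat) : {set {set ('I_s + 'I_t)%type}} :=
  [set [set inl a; inr b] | a : 'I_s, b : 'I_t].

Definition Kbip (s t : nat) : hypergraph ('I_s + 'I_t)%type :=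
  Hypergraph (@eset_subT _ (Kbip_edges s t)).

Lemma triangle_uniform : uniform 2 triangle.
Proof. by move=> e; rewrite inE => /eqP. Qed.

Lemma Kbip_uniform (s t : nat) : uniform 2 (Kbip s t).
Proof. by move=> e /imset2P[a b _ _ ->]; rewrite cards2. Qed.

Definition exact_Kbip_free (T : finType) (r s t : nat) (H : hypergraph T)
    (V1 V2 : {set T}) : Prop :=
  ~ exists (B : hypergraph T) (i : 'I_s + 'I_t -> T),
      [/\ subhypergraph B H,
          berge_at r (Kbip s t) B i,
          forall a : 'I_s, i (inl a) \in V1 &
          forall b : 'I_t, i (inr b) \in V2].

(* Main.v *)
(** Join a head vertex to a mass vertex whenever some edge of [H] contains both.
    By linearity this bipartite shadow graph has [(r - 1) * e(H)] edges. It has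
    no [K_{s,t}] with the [s]-part in the head: triangle-freeness forces the
    edges of [H] witnessing such a [K_{s,t}] to be distinct, so they would form
    an exact Berge-[K_{s,t}]. What remains is Nikiforov's bound for the
    Zarankiewicz problem, by induction on [k]. For [k = 0] it is the
    Kovari-Sos-Turan count. In the step, for each mass vertex [w] the graph
    between the neighbours of [w] and the other mass vertices has no
    [K_{s,t-1}]; summing the induction hypothesis over [w] and applying
    Cauchy-Schwarz gives a quadratic inequality for the number of edges. *)

Require Import Defs.
From mathcomp Require Import all_boot all_order all_algebra.
From mathcomp Require Import reals exp.
From mathcomp Require Import zify ring lra.
Import Order.TTheory GRing.Theory Num.Theory.
Local Open Scope ring_scope.

Set Implicit Arguments.
Unset Strict Implicit.
Unset Printing Implicit Defensive.

(** * Power-mean and falling-factorial inequalities over the naturals *)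

(** Rearrangement: [y - x] and [y ^ s - x ^ s] have the same sign. *)
Lemma mulnX_add_leq (x y s : nat) :
  (x * y ^ s + y * x ^ s <= x * x ^ s + y * y ^ s)%N.
Proof.
wlog xy : x y / (x <= y)%N.
  move=> W; case/orP: (leq_total x y) => /W // {}W.
  by rewrite addnC [leqRHS]addnC.
have h : (x ^ s <= y ^ s)%N by case: s => // s; rewrite leq_exp2r.
nia.
Qed.

(** Once doubled, both sides are sums over pairs [(i, j)], compared termwise by [mulnX_add_leq]. *)
Lemma chebyshev_sum_expn (I : finType) (B : {set I}) (x : I -> nat) (s : nat) :
  ((\sum_(i in B) x i) * (\sum_(i in B) x i ^ s)
     <= #|B| * \sum_(i in B) x i * x i ^ s)%N.
Proof.
rewrite -leq_double -!addnn.
have E1 : (#|B| * (\sum_(i in B) x i * x i ^ s) =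
    \sum_(i in B) \sum_(j in B) x i * x i ^ s)%N.
  rewrite big_distrr /=; apply: eq_bigr => i _.
  by rewrite sum_nat_const.
rewrite {2}E1 -sum_nat_const.
have -> : ((\sum_(i in B) x i) * (\sum_(i in B) x i ^ s) =
    \sum_(i in B) \sum_(j in B) x i * x j ^ s)%N.
  by rewrite big_distrl /=; apply: eq_bigr => i _; rewrite big_distrr.
rewrite {2}exchange_big -!big_split /=; apply: leq_sum => i _.
rewrite -!big_split /=; apply: leq_sum => j _.
by rewrite [leqRHS]addnC mulnX_add_leq.
Qed.

Lemma power_mean_nat (I : finType) (B : {set I}) (x : I -> nat) (s : nat) :
  ((\sum_(i in B) x i) ^ s.+1 <= #|B| ^ s * \sum_(i in B) x i ^ s.+1)%N.
Proof.
elim: s => [|s IH].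
  by rewrite expn1 expn0 mul1n; under [leqRHS]eq_bigr do rewrite expn1.
rewrite expnS; apply: (leq_trans (leq_mul (leqnn _) IH)).
rewrite mulnCA expnSr -mulnA leq_mul2l; apply/orP; right.
under [X in (_ <= _ * X)%N]eq_bigr do rewrite expnS.
exact: chebyshev_sum_expn.
Qed.

(** The smallest of the [s.+1] factors of [d ^_ s.+1] is [d - s]; truncation makes the left side
    vanish when [d <= s]. *)
Lemma leq_subn_expn_ffact (d s : nat) : ((d - s) ^ s.+1 <= d ^_ s.+1)%N.
Proof.
elim: s d => [|s IH] d; first by rewrite subn0 expn1 ffactn1.
case: d => [|d]; first by rewrite sub0n exp0n.
rewrite subSS expnS ffactSS; apply: leq_mul (IH d); lia.
Qed.

Lemma ffact_leq_expn (m s : nat) : (m ^_ s <= m ^ s)%N.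
Proof.
elim: s m => [|s IH] m //; rewrite ffactnS expnS leq_mul2l.
apply/orP; right; apply: leq_trans (IH _) _.
by case: s {IH} => // s; rewrite leq_exp2r // leq_pred.
Qed.

(** * Double counting in bipartite graphs *)

Section Bipartite.
Variables (T1 T2 : finType) (E : T1 -> T2 -> bool).
Implicit Types (A S : {set T1}) (B : {set T2}).

Definition nbrs A w := [set v in A | E v w].

Definition common_nbrs B S := [set w in B | [forall v in S, E v w]].

Definition bip_edges A B := (\sum_(w in B) #|nbrs A w|)%N.

(** This encodes the absence of a $K_{s,q+1}$ with its $s$-part in [A] and the other part in [B];
    note the shift from [q] to $q+1$. *)
Definition common_le A B s q :=
  forall S, S \subset A -> #|S| = s -> (#|common_nbrs B S| <= q)%N.

Lemma bip_edgesE A B :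
  bip_edges A B = (\sum_(w in B) \sum_(v in A) E v w)%N.
Proof.
apply: eq_bigr => w _; rewrite -sum1_card big_mkcond [RHS]big_mkcond /=.
by apply: eq_bigr => v _; rewrite inE; case: (v \in A); case: (E v w).
Qed.

(** Both sides count the stars: a centre [w] in [B] with [s] chosen neighbours in [A]. *)
Lemma sum_bin_deg A B s :
  (\sum_(w in B) 'C(#|nbrs A w|, s) =
   \sum_(S : {set T1} | (S \subset A) && (#|S| == s)) #|common_nbrs B S|)%N.
Proof.
under eq_bigr => w _ do rewrite -cards_draws -sum1_card big_mkcond.
under [RHS]eq_bigr => S _ do rewrite -sum1_card big_mkcond.
rewrite exchange_big [RHS]big_mkcond /=; apply: eq_bigr => S _.
rewrite big_mkcond -big_mkcondr /=.
have sub w : (S \subset nbrs A w) = (S \subset A) && [forall v in S, E v w].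
  apply/subsetP/andP => [h|[/subsetP hA /forall_inP hE] v vS].
    by split; [apply/subsetP|apply/forall_inP] => v /h; rewrite inE => /andP[].
  by rewrite inE hA ?hE.
case: ifP => [/andP[SA cS]|SA].
  rewrite big_mkcond; apply: eq_bigr => w _.
  by rewrite !inE sub SA cS; case: (w \in B); case: [forall _ in _, _].
apply: big1_seq => w _; rewrite !inE sub.
by case: (S \subset A) (#|S| == s) SA => [] [] //=; rewrite ?andbF.
Qed.

(** The power mean reduces the claim to [(d - s) ^ s.+1] summed over the degrees [d]. This is at
    most [s.+1]! times the number of stars, and each leaf set has at most [q] centres. *)
Lemma kst_nat A B s q : common_le A B s.+1 q ->
  ((\sum_(w in B) (#|nbrs A w| - s)) ^ s.+1 <= #|B| ^ s * (q * #|A| ^ s.+1))%N.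
Proof.
move=> hK; apply: leq_trans (power_mean_nat _ _ _) _.
rewrite leq_mul2l; apply/orP; right.
have h : (\sum_(w in B) (#|nbrs A w| - s) ^ s.+1 <=
    \sum_(w in B) 'C(#|nbrs A w|, s.+1) * s.+1`!)%N.
  by apply: leq_sum => w _; rewrite bin_ffact leq_subn_expn_ffact.
apply: leq_trans h _; rewrite -big_distrl /= sum_bin_deg.
apply: (@leq_trans ('C(#|A|, s.+1) * q * s.+1`!)); last first.
  by rewrite mulnAC bin_ffact mulnC leq_mul2l ffact_leq_expn orbT.
rewrite leq_mul2r -cards_draws -sum_nat_const; apply/orP; right.
rewrite [leqRHS](eq_bigl (fun S : {set T1} => (S \subset A) && (#|S| == s.+1)));
  last by move=> S; rewrite inE.
by apply: leq_sum => S /andP[SA /eqP cS]; apply: hK.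
Qed.

Lemma bip_edges_sum_sub A B s :
  (bip_edges A B <= \sum_(w in B) (#|nbrs A w| - s) + s * #|B|)%N.
Proof.
rewrite mulnC -sum_nat_const -big_split /=; apply: leq_sum => w _; lia.
Qed.

(** The vertex [w] is itself a common neighbour of every subset of [nbrs A w], so deleting it lowers
    the bound by one. *)
Lemma common_le_link A B s q w : w \in B -> common_le A B s q.+1 ->
  common_le (nbrs A w) (B :\ w) s q.
Proof.
move=> wB hK S /subsetP SN cS.
have SA : S \subset A by apply/subsetP => v /SN; rewrite inE => /andP[].
have := hK S SA cS; rewrite (cardsD1 w).
have -> : w \in common_nbrs B S.
  by rewrite inE wB; apply/forall_inP => v /SN; rewrite inE => /andP[].
rewrite add1n ltnS; apply: leq_trans; apply/subset_leq_card/subsetP => u.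
by rewrite !inE => /andP[/andP[-> ->] ->].
Qed.

Lemma bip_edges_setD1 A B w : w \in B ->
  bip_edges (nbrs A w) B = (#|nbrs A w| + bip_edges (nbrs A w) (B :\ w))%N.
Proof.
move=> wB; rewrite /bip_edges (big_setD1 _ wB) /=; congr (_ + _)%N.
by apply: eq_card => v; rewrite !inE -andbA andbb.
Qed.

(* Both sides count the paths with both ends in [B] and centre in [A]:
   their number is the sum of the squared degrees over [A]. *)
Lemma bip_edges_sqr A B :
  (bip_edges A B ^ 2 <= #|A| * \sum_(w in B) bip_edges (nbrs A w) B)%N.
Proof.
rewrite bip_edgesE exchange_big /=.
apply: leq_trans (power_mean_nat _ _ _) _; rewrite expn1.
rewrite leq_mul2l; apply/orP; right; apply: eq_leq.
under [RHS]eq_bigr => w _ do rewrite bip_edgesE exchange_big /=.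
transitivity (\sum_(w in B) \sum_(v in A) E v w * \sum_(u in B) E v u)%N.
  rewrite [RHS]exchange_big; apply: eq_bigr => v _.
  by rewrite -big_distrl.
apply: eq_bigr => w _; rewrite big_mkcond [RHS]big_mkcond /=.
apply: eq_bigr => v _; rewrite inE.
by case: (v \in A); case: (E v w); rewrite ?mul1n ?mul0n.
Qed.

End Bipartite.

(** * Real-valued Zarankiewicz bounds *)

Section Zarankiewicz.
Variables (R : realType) (T1 T2 : finType) (E : T1 -> T2 -> bool).

Lemma kst_real (A : {set T1}) (B : {set T2}) (n s q : nat) :
  (0 < n)%N -> (#|B| <= n)%N -> common_le E A B s.+1 q ->
  (bip_edges E A B)%:R <=
    q%:R `^ (1 / s.+1%:R) * #|A|%:R * n%:R `^ (1 - 1 / s.+1%:R)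
      + s%:R * n%:R :> R.
Proof.
move=> n0 Bn hK.
have /(_ s) := bip_edges_sum_sub E A B.
have := kst_nat hK.
set x := (\sum_(w in B) _)%N => hx he.
have hx' : (x ^ s.+1 <= n ^ s * (q * #|A| ^ s.+1))%N.
  apply: leq_trans hx _; rewrite leq_mul2r; apply/orP; right.
  by case: (s) => // s'; rewrite leq_exp2r.
have {}he : (bip_edges E A B <= x + s * n)%N by nia.
apply: (@le_trans _ _ (x%:R + s%:R * n%:R)).
  by rewrite -natrM -natrD ler_nat.
(* Raising to the power [s.+1] turns the exponents of [q] and [n] into the integers 1 and [s], which
   leaves [hx']. *)
rewrite lerD2r -(@ler_pXn2r _ s.+1) ?nnegrE ?mulr_ge0 ?powR_ge0 //.
rewrite !exprMn -!powR_mulrn ?powR_ge0 // -!powRrM mulrBl !mulfVK ?pnatr_eq0 //.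
have -> : 1 * s.+1%:R - 1 = s%:R :> R by rewrite -natr1; lra.
rewrite powRr1 // !powR_mulrn // -!natrX -!natrM.
by rewrite ler_nat mulnC.
Qed.

(** Both [q] and the upper bound [n] on the size of [B] stay fixed in the induction on [k], so every
    link [nbrs E A w], [B :\ w] gets the same constants. *)
Lemma zarankiewicz_bound (n s q : nat) : (0 < q)%N ->
  forall (k : nat) (A : {set T1}) (B : {set T2}),
  (#|B| <= n)%N -> common_le E A B s.+1 (q + k) ->
  (bip_edges E A B)%:R <=
    q%:R `^ (1 / s.+1%:R) * #|A|%:R * n%:R `^ (1 - 1 / s.+1%:R)
      + s%:R * n%:R `^ (1 + k%:R / s.+1%:R) + k%:R * #|A|%:R :> R.
Proof.
move=> q0; case: (posnP n) => [-> k A B|n0].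
  rewrite leqn0 cards_eq0 => /eqP -> _.
  by rewrite /bip_edges big_set0 !addr_ge0 ?mulr_ge0 ?powR_ge0.
elim=> [|k IH] A B Bn hK.
  rewrite mul0r addr0 powRr1 // mul0r addr0.
  by apply: kst_real; rewrite // -(addn0 q).
pose c : R := q%:R `^ (1 / s.+1%:R).
pose p : R := n%:R `^ (1 - 1 / s.+1%:R).
pose D (j : nat) : R := n%:R `^ (1 + j%:R / s.+1%:R).
have c1 : 1 <= c.
  rewrite /c -[leLHS](powRr0 q%:R); apply: ler_powR; first by rewrite ler1n.
  by rewrite divr_ge0.
have p0 : 0 <= p by apply: powR_ge0.
have D0 j : 0 <= D j by apply: powR_ge0.
(* The exponents on both sides add up to $2 + k/(s+1)$; this identity lets the error term grow from
   [D k] to [D k.+1]. *)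
have pD : p * D k.+1 = n%:R * D k.
  rewrite /p /D -{3}(@powRr1 _ n%:R) //
    -!powRD ?pnatr_eq0 -?lt0n ?n0 ?implybT //.
  by congr (_ `^ _); ring.
set e := bip_edges E A B; set a := #|A|.
(* Sum the induction hypothesis over [w]. The edges at [w] itself, lost in passing to [B :\ w], turn
   the coefficient [k] into [k.+1]. *)
have hsum : e%:R ^+ 2 <=
    a%:R * ((c * p + k.+1%:R) * e%:R + s%:R * (n%:R * D k)) :> R.
  apply: (@le_trans _ _ (a * \sum_(w in B) bip_edges E (nbrs E A w) B)%:R).
    by rewrite -natrX ler_nat bip_edges_sqr.
  rewrite natrM ler_wpM2l // natr_sum.
  apply: (@le_trans _ _ (\sum_(w in B)
      ((c * p + k.+1%:R) * #|nbrs E A w|%:R + s%:R * D k))).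
    apply: ler_sum => w wB; rewrite bip_edges_setD1 // natrD.
    have h : (#|B :\ w| <= n)%N.
      by apply: leq_trans Bn; rewrite subset_leq_card // subD1set.
    have hK' : common_le E A B s.+1 (q + k).+1 by rewrite -addnS.
    have := IH _ _ h (common_le_link wB hK').
    rewrite -/c -/p -/(D k) -natr1; lra.
  rewrite big_split /= -mulr_sumr -natr_sum lerD2l sumr_const.
  by rewrite -[leLHS]mulr_natl [leRHS]mulrCA ler_wpM2r ?mulr_ge0 ?ler_nat.
rewrite -/c -/p -/(D k.+1) leNgt; apply/negP => hlt.
have a0 : 0 <= a%:R :> R by [].
have s0 : 0 <= s%:R :> R by [].
have k0 : 0 <= k.+1%:R :> R by [].
(* If the bound fails, then [e] is at least [a * p] because [1 <= c]. Multiplying the failed bound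
   by [e] and replacing [e] by [a * p] in the [D k.+1] term contradicts [hsum]. *)
have hap : a%:R * p <= e%:R.
  have : 0 <= s%:R * D k.+1 by rewrite mulr_ge0.
  have : 0 <= k.+1%:R * a%:R :> R by rewrite mulr_ge0.
  have : 0 <= (c - 1) * (a%:R * p) by rewrite !mulr_ge0 ?subr_ge0.
  lra.
have e0 : 0 < e%:R :> R.
  apply: le_lt_trans hlt; rewrite !addr_ge0 ?mulr_ge0 //; lra.
have h1 : 0 < e%:R * (e%:R - (c * a%:R * p + s%:R * D k.+1 + k.+1%:R * a%:R)).
  by rewrite mulr_gt0 // subr_gt0.
have h2 : 0 <= (e%:R - a%:R * p) * (s%:R * D k.+1).
  by rewrite mulr_ge0 ?subr_ge0 ?mulr_ge0.
have h3 : a%:R * (s%:R * (n%:R * D k)) = a%:R * p * (s%:R * D k.+1).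
  by rewrite -pD; lra.
rewrite mulrDr h3 in hsum; lra.
Qed.

End Zarankiewicz.

(** * The shadow graph of a linear hm-bipartite hypergraph *)

Section Shadow.
Variables (T : finType) (r : nat) (H : hypergraph T).
Hypothesis Hunif : uniform r H.

Definition shadow (v w : T) := [exists h in eset H, (v \in h) && (w \in h)].

(** Taking a set rather than a pair lets it act directly on the image of a graph edge; [set0] is a
    dummy value when no edge covers [P]. *)
Definition covering_edge (P : {set T}) : {set T} :=
  odflt set0 [pick h in eset H | P \subset h].

Lemma covering_edgeP (v w : T) : shadow v w ->
  [/\ covering_edge [set v; w] \in eset H, v \in covering_edge [set v; w]
    & w \in covering_edge [set v; w]].
Proof.
case/exists_inP => h hH /andP[vh wh]; rewrite /covering_edge.
case: pickP => [h' /andP[h'H /subsetP sub]|/(_ h)] /=.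
  by rewrite h'H !sub ?inE ?eqxx ?orbT.
by rewrite hH subUset !sub1set vh wh.
Qed.

Lemma linear_eq_edge (h h' : {set T}) (v w : T) : linear_hypergraph H ->
  h \in eset H -> h' \in eset H -> v != w ->
  v \in h -> v \in h' -> w \in h -> w \in h' -> h = h'.
Proof.
move=> Hlin hH h'H vw vh vh' wh wh'; apply/eqP/negPn/negP => /(Hlin _ _ hH h'H).
rewrite leqNgt => /negP; apply; apply/card_gt1P; exists v, w.
by rewrite !inE vh vh' wh wh'.
Qed.

(* The edge of the triangle missing [x] is mapped to [f x]. *)
Lemma berge_triangle (f : 'I_3 -> {set T}) (i : 'I_3 -> T) :
  injective f -> injective i -> (forall x, f x \in eset H) ->
  (forall x y, x != y -> i y \in f x) -> ~ berge_free r triangle H.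
Proof.
move=> finj iinj fH fi; apply.
pose phi (e : {set 'I_3}) := f (odflt ord0 [pick x in ~: e]).
have edge (e : {set 'I_3}) : e \in eset triangle ->
    exists2 x, e = [set~ x] & phi e = f x.
  rewrite inE => ce.
  have /cards1P [x ex] : #|~: e| == 1%N.
    by have := cardsC e; rewrite (eqP ce) card_ord; lia.
  exists x; first by rewrite -ex setCK.
  rewrite /phi ex; case: pickP => [y|/(_ x)]; last by rewrite set11.
  by rewrite inE => /eqP ->.
have sub : forall h, h \in phi @: eset triangle -> h \subset vset H.
  by move=> h /imsetP[e /edge [x _ ->] ->]; apply: eset_sub.
exists (Hypergraph sub), i; split; first split => //=.
  by apply/subsetP => h /imsetP[e /edge [x _ ->] ->].
split => /=.
- by move=> h /imsetP[e /edge [x _ ->] ->]; apply: Hunif.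
- by move=> x y _ _; apply: iinj.
- apply/subsetP => _ /imsetP[y _ ->].
  (* The cyclic successor [ordS y] differs from [y], so [f (ordS y)] is an edge through [i y]. *)
  have /subsetP := eset_sub (fH (ordS y)); apply; apply: fi.
  by case: y => -[|[|[|]]].
exists phi; split=> // [e e' /edge [x -> ->] /edge [x' -> ->] /finj -> //|].
move=> e /edge [x -> ->]; apply/subsetP => _ /imsetP[y yx ->].
by apply: fi; move: yx; rewrite !inE eq_sym.
Qed.

Variables V1 V2 : {set T}.
Hypothesis Hbip : hm_bipartition r H V1 V2.
Hypothesis Hlin : linear_hypergraph H.

Lemma head_uniq (h : {set T}) (v v' : T) :
  h \in eset H -> v \in V1 -> v' \in V1 ->
  v \in h -> v' \in h -> v = v'.
Proof.
case: Hbip => _ _ /(_ h) hb /hb[/eqP/cards1P[x hx] _] vV v'V vh v'h.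
have : v \in h :&: V1 by rewrite inE vh.
have : v' \in h :&: V1 by rewrite inE v'h.
by rewrite hx !inE => /eqP -> /eqP ->.
Qed.

Lemma head_neq_mass (v w : T) : v \in V1 -> w \in V2 -> v != w.
Proof.
case: Hbip => _ dis _ vV; apply: contraL => /eqP <-.
by rewrite (disjointFr dis).
Qed.

(** Each edge contains one head and [r - 1] mass vertices, hence [r - 1] head-mass pairs, and by
    linearity no pair lies in two edges. *)
Lemma shadow_edges : (#|eset H| * (r - 1) <= bip_edges shadow V1 V2)%N.
Proof.
have -> : (#|eset H| * (r - 1) =
    \sum_(h in eset H) \sum_(w in V2) \sum_(v in V1) ((v \in h) && (w \in h)))%N.
  rewrite -sum_nat_const; apply: eq_bigr => h hH.
  have [_ _ /(_ h hH) [c1 c2]] := Hbip.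
  rewrite -c2 -sum1_card [LHS]big_mkcond [RHS]big_mkcond; apply: eq_bigr => w _.
  rewrite inE andbC; case: (w \in V2) => //=.
  under eq_bigr => v _ do rewrite andbC.
  case: (w \in h) => /=; last by rewrite big1.
  rewrite -c1 -sum1_card [LHS]big_mkcond [RHS]big_mkcond; apply: eq_bigr => v _.
  by rewrite inE andbC; case: (v \in V1); case: (v \in h).
rewrite bip_edgesE exchange_big /=; apply: leq_sum => w wV.
rewrite exchange_big /=; apply: leq_sum => v vV.
have vw := head_neq_mass vV wV.
case: (boolP (shadow v w)) => [/exists_inP[h hH /andP[vh wh]]|/exists_inPn no].
  rewrite (bigD1 h) //= big1 ?addn0; first by rewrite leq_b1.
  move=> h' /andP[h'H /eqP ne]; apply/eqP; rewrite eqb0.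
  apply/negP => /andP[vh' wh'].
  by apply: ne; apply: linear_eq_edge vw _ _ _ _.
by rewrite big1 // => h /no /negbTE ->.
Qed.

(* If [w <> w'], then [h], through [w] and [w'], and the two edges joining them
   to [v'] would form a Berge triangle. *)
Lemma common_nbrs_separate (v v' w w' : T) (h : {set T}) :
  berge_free r triangle H ->
  v \in V1 -> v' \in V1 -> v != v' -> w \in V2 -> w' \in V2 ->
  shadow v' w -> shadow v' w' ->
  h \in eset H -> v \in h -> w \in h -> w' \in h -> w = w'.
Proof.
move=> C3 vV v'V vv' wV w'V /exists_inP[h1 h1H /andP[v'1 w1]].
move=> /exists_inP[h2 h2H /andP[v'2 w'2]] hH vh wh w'h.
apply/eqP/negPn/negP => ww'.
(* The only head vertex of [h] is [v], so [h1] and [h2], which contain [v'], differ from [h]. Were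
   they equal, they would share [w] and [w'] with [h], against linearity. *)
have v'h : v' \notin h.
  by apply: contra vv' => v'h; rewrite (@head_uniq h v v').
have h1h : h1 <> h by move=> E; rewrite -E v'1 in v'h.
have h2h : h2 <> h by move=> E; rewrite -E v'2 in v'h.
have h12 : h1 <> h2.
  move=> E; apply: h1h; apply: (@linear_eq_edge h1 h w w') => //.
  by rewrite E.
have v'w := head_neq_mass v'V wV.
have v'w' := head_neq_mass v'V w'V.
(* The lists are aligned so that each edge is opposite the vertex at the same position, as
   [berge_triangle] expects. *)
pose f (x : 'I_3) := nth set0 [:: h; h2; h1] x.
pose i (x : 'I_3) := nth v' [:: v'; w; w'] x.
have uf : uniq [:: h; h2; h1].
  rewrite /= !inE negb_or andbT; apply/andP; split; last by apply/eqP => /esym.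
  by apply/andP; split; apply/eqP => /esym.
have ui : uniq [:: v'; w; w'] by rewrite /= !inE negb_or v'w v'w' ww'.
apply: (@berge_triangle f i) C3.
- by move=> x y /eqP; rewrite nth_uniq ?ltn_ord // => /eqP/val_inj.
- by move=> x y /eqP; rewrite nth_uniq ?ltn_ord // => /eqP/val_inj.
- by case=> -[|[|[|]]].
- by case=> -[|[|[|]]] // ? [[|[|[|]]]].
Qed.

Lemma shadow_common_le (s t : nat) : (2 <= s)%N ->
  exact_Kbip_free r s t.+1 H V1 V2 -> berge_free r triangle H ->
  common_le shadow V1 V2 s t.
Proof.
move=> s2 Hex C3 S /subsetP SV cS; rewrite leqNgt; apply/negP => ct.
apply: Hex; subst s.
set W := common_nbrs _ _ _ in ct.
(* There may be more than [t.+1] common neighbours; [widen_ord] selects the first [t.+1] of them. *)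
pose i (x : 'I_#|S| + 'I_t.+1) : T :=
  match x with inl a => enum_val a | inr b => enum_val (widen_ord ct b) end.
have iS a : i (inl a) \in S by apply: enum_valP.
have i1 a : i (inl a) \in V1 by apply: SV.
have iW b : i (inr b) \in W by apply: enum_valP.
have i2 b : i (inr b) \in V2 by have := iW b; rewrite inE => /andP[].
have ish a b : shadow (i (inl a)) (i (inr b)).
  by have := iW b; rewrite inE => /andP[_ /forall_inP]; apply.
have iinj : injective i.
  move=> [a|b] [a'|b'] => [/enum_val_inj->//|/eqP|/eqP|/enum_val_inj].
  - by rewrite (negbTE (head_neq_mass (i1 a) (i2 b'))).
  - by rewrite eq_sym (negbTE (head_neq_mass (i1 a') (i2 b))).
  - by move/(congr1 val) => /= /val_inj ->.
pose phi (e : {set 'I_#|S| + 'I_t.+1}) := covering_edge (i @: e).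
have phiE a b :
    phi [set inl a; inr b] = covering_edge [set i (inl a); i (inr b)].
  by rewrite /phi imsetU1 imset_set1.
have sub h : h \in phi @: eset (Kbip #|S| t.+1) -> h \in eset H.
  case/imsetP => _ /imset2P[a b _ _ ->] ->; rewrite phiE.
  by case: (covering_edgeP (ish a b)).
exists (Hypergraph (fun h hB => eset_sub (sub h hB))), i; split=> //.
  by split=> //=; apply/subsetP.
split => /=.
- by move=> h /sub; apply: Hunif.
- by move=> x y _ _; apply: iinj.
- apply/subsetP => _ /imsetP[x _ ->]; have [<- _ _] := Hbip.
  by case: x => [a|b]; rewrite inE ?i1 ?i2 ?orbT.
exists phi; split=> // [_ _ /imset2P[a b _ _ ->] /imset2P[a' b' _ _ ->]|].
  (* Injectivity of [phi]: a common covering edge has a single head vertex, whence [a = a']. *)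
  rewrite !phiE => E.
  have [hH ah bh] := covering_edgeP (ish a b).
  have [_ ah' bh'] := covering_edgeP (ish a' b').
  rewrite -E in ah' bh'.
  have [->] := iinj _ _ (head_uniq hH (i1 a) (i1 a') ah ah').
  (* Since [S] has at least two elements, it contains another head vertex [v'], also adjacent to
     both mass vertices; triangle-freeness then gives [b = b']. *)
  have [v' v'S vv'] : exists2 v', v' \in S & i (inl a) != v'.
    have /card_gt1P [x [y [xS yS xy]]] := s2.
    have [ax|] := eqVneq (i (inl a)) x; last by exists x.
    by exists y; rewrite // ax.
  have v'b c : shadow v' (i (inr c)).
    by have := iW c; rewrite inE => /andP[_ /forall_inP]; apply.
  have [->//] := iinj _ _ (common_nbrs_separate C3 (i1 a) (SV _ v'S) vv'
    (i2 b) (i2 b') (v'b b) (v'b b') hH ah bh bh').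
move=> _ /imset2P[a b _ _ ->]; rewrite phiE imsetU1 imset_set1.
by have [_ ah bh] := covering_edgeP (ish a b); rewrite subUset !sub1set ah bh.
Qed.

End Shadow.

Theorem theorem3p6 (R : realType) (r s t m n : nat)
    (T : finType) (H : hypergraph T) (V1 V2 : {set T})
    (hr : (2 <= r)%N) (hs : (2 <= s)%N) (ht : (2 <= t)%N)
    (Hunif : uniform r H) (Hlin : linear_hypergraph H)
    (Hbip : hm_bipartition r H V1 V2)
    (cardV1 : #|V1| = m) (cardV2 : #|V2| = n)
    (Hexact : exact_Kbip_free r s t H V1 V2)
    (HC3 : berge_free r triangle H) :
  forall k : nat, (k <= t - 2)%N ->
    (#|eset H|%:R : R) <=
      (t%:R - k%:R - 1) `^ (1 / s%:R) / (r%:R - 1) * m%:R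
          * n%:R `^ (1 - 1 / s%:R)
      + (s%:R - 1) / (r%:R - 1) * n%:R `^ (1 + k%:R / s%:R)
      + k%:R * m%:R.
Proof.
move=> k kt; case: t ht kt Hexact => // t ht kt Hexact.
have hK := shadow_common_le Hunif Hbip Hlin hs Hexact HC3.
(* Here [t] is the original parameter minus one, so [q] is the $t-k-1$ of the statement, and
   [k <= t - 2] there makes it positive. *)
have [q q0 tE] : exists2 q, (0 < q)%N & t = (q + k)%N by exists (t - k)%N; lia.
have he := shadow_edges Hbip Hlin.
case: s hs hK {Hexact} => // s hs hK; rewrite tE in hK.
have V2n : (#|V2| <= n)%N by rewrite cardV2.
have := zarankiewicz_bound R q0 V2n hK.
have -> : t.+1%:R - k%:R - 1 = q%:R :> R by rewrite tE -natr1 natrD; lra.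
have -> : s.+1%:R - 1 = s%:R :> R by rewrite -natr1; lra.
rewrite cardV1.
set c := _ `^ _; set p := _ `^ _; set d := _ `^ _ => hz.
have r1 : 1 <= r%:R - 1 :> R.
  by rewrite lerBrDr (ler_nat _ 2).
have km : 0 <= k%:R * m%:R :> R by rewrite mulr_ge0.
rewrite -(ler_pM2r (_ : 0 < r%:R - 1)); last by lra.
(* After multiplication by [r - 1], the first two terms match the Zarankiewicz bound exactly, while
   [k * m] only grows because [r - 1] is at least 1. *)
apply: (@le_trans _ _ (c * m%:R * p + s%:R * d + k%:R * m%:R)).
  by apply: le_trans hz; rewrite -(natrB _ (ltnW hr)) -natrM ler_nat.
rewrite mulrDl; apply: lerD; last by rewrite ler_peMr.
have r0 : r%:R - 1 != 0 :> R by rewrite gt_eqF //; lra.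
by rewrite mulrDl !(mulrAC _ _ (r%:R - 1)) !mulfK.
Qed.
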